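(* Let $(B,+,\circ)$ and $(S,+_s,\bullet)$ be left skew braces and let $z\in B$ be $u$-distributive. Consider the solutions of the braid equation $\check r_1:S\times S\to S\times S$, $$\check r_1(a,b)=\bigl(\sigma_a(b),\ \sigma_a(b)^{-1}\bullet a\bullet b\bigr),\qquad \sigma_a(b)=a\bullet b-_s a,$$ and $\check r_z:B\times B\to B\times B$, $$\check r_z(a,b)=\bigl(\sigma^z_a(b),\ \sigma^z_a(b)^{-1}\circ a\circ b\bigr),\qquad \sigma^z_a(b)=a\circ b-a\circ z+z .$$ Let $\eta\in B$ be such that $z+\eta\neq\eta\circ z$, and let $f:S\to B$ be a function such that $\eta,1\in\mathrm{Im}(f)$ and $f(1)+\eta=\eta+f(1)$. Then $f$ is not a homomorphism of Yang-Baxter solutions, i.e. $$(f\times f)\,\check r_1\neq\check r_z\,(f\times f).$$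
   Context: A left skew brace is a set $B$ with two group operations $+$ (not necessarily commutative) and $\circ$ such that $a\circ(b+c)=a\circ b-a+a\circ c$ for all $a,b,c\in B$; the two groups then have the same neutral element, denoted $1$ (likewise for $S$, with neutral element also denoted $1$, additive inverse $-_s$, and inverse in $(S,\bullet)$ denoted by the power $-1$). In $B$, $-a$ denotes the inverse in $(B,+)$, $a^{-1}$ the inverse in $(B,\circ)$; the multiplication binds more strongly than $\pm$. An element $z\in B$ is called $u$-distributive if $(a-b+c)\circ z=a\circ z-b\circ z+c\circ z$ for all $a,b,c\in B$. A map $\check r:X\times X\to X\times X$ is a solution of the braid equation if $(\check r\times\mathrm{id})(\mathrm{id}\times\check r)(\check r\times\mathrm{id})=(\mathrm{id}\times\check r)(\check r\times\mathrm{id})(\mathrm{id}\times\check r)$. A function $f:S\to X$ is a homomorphism of Yang-Baxter solutions from $\check r$ (on $S$) to $\hat r$ (on $X$) if $(f\times f)\check r=\hat r(f\times f)$. *)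

(* Defs.v *)
From mathcomp Require Import ssreflect ssrfun.

Set Implicit Arguments.
Unset Strict Implicit.
Unset Printing Implicit Defensive.

(* MathComp's groupType is not used here: it requires a choice structure on the
   carrier, and two of them cannot share a carrier without type aliases. *)
Record is_group (G : Type) (e : G) (inv : G -> G) (op : G -> G -> G) : Prop :=
  IsGroup {
    groupA : associative op;
    group1l : left_id e op;
    group1r : right_id e op;
    groupVl : left_inverse e inv op;
    groupVr : right_inverse e inv op
  }.

Declare Scope brace_scope.
Delimit Scope brace_scope with brace.

(* [brace_mul] is the circle operation; it is written [*] so that it binds more
   strongly than [+] and [-].  The additive group is not assumed commutative. *)
Record left_skew_brace : Type := LeftSkewBrace {
  brace_sort :> Type;
  brace_zero : brace_sort;
  brace_opp : brace_sort -> brace_sort;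
  brace_add : brace_sort -> brace_sort -> brace_sort;
  brace_one : brace_sort;
  brace_inv : brace_sort -> brace_sort;
  brace_mul : brace_sort -> brace_sort -> brace_sort;
  brace_addP : is_group brace_zero brace_opp brace_add;
  brace_mulP : is_group brace_one brace_inv brace_mul;
  brace_mulDr : forall a b c : brace_sort,
    brace_mul a (brace_add b c)
    = brace_add (brace_add (brace_mul a b) (brace_opp a)) (brace_mul a c)
}.

Bind Scope brace_scope with brace_sort.
Arguments brace_zero {_}.
Arguments brace_one {_}.

Notation "0" := brace_zero : brace_scope.
Notation "1" := brace_one : brace_scope.
Notation "- a" := (brace_opp a) : brace_scope.
Notation "a + b" := (brace_add a b) : brace_scope.
Notation "a - b" := (brace_add a (brace_opp b)) : brace_scope.
Notation "a ^-1" := (brace_inv a) : brace_scope.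
Notation "a * b" := (brace_mul a b) : brace_scope.
Local Open Scope brace_scope.

Definition u_distributive (B : left_skew_brace) (z : B) : Prop :=
  forall a b c : B, (a - b + c) * z = a * z - b * z + c * z.

Section BraidEquation.
Variable X : Type.
Implicit Types (r : X * X -> X * X) (t : X * X * X).

Definition braid12 r t : X * X * X := (r t.1, t.2).

Definition braid23 r t : X * X * X :=
  let p := r (t.1.2, t.2) in (t.1.1, p.1, p.2).

Definition braid_equation r : Prop :=
  braid12 r \o braid23 r \o braid12 r =1 braid23 r \o braid12 r \o braid23 r.

Record yb_solution : Type := YBSolution {
  yb_map :> X * X -> X * X;
  yb_braid : braid_equation yb_map
}.

End BraidEquation.

Definition pair_map (X Y : Type) (f : X -> Y) (p : X * X) : Y * Y :=
  (f p.1, f p.2).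

Definition yb_hom (X Y : Type) (r : yb_solution X) (s : yb_solution Y)
    (f : X -> Y) : Prop :=
  pair_map f \o r =1 s \o pair_map f.

Definition sigma (S : left_skew_brace) (a b : S) : S := a * b - a.

Definition r_one (S : left_skew_brace) (p : S * S) : S * S :=
  let: (a, b) := p in (sigma a b, (sigma a b)^-1 * a * b).

Definition sigma_z (B : left_skew_brace) (z a b : B) : B := a * b - a * z + z.

Definition r_z (B : left_skew_brace) (z : B) (p : B * B) : B * B :=
  let: (a, b) := p in (sigma_z z a b, (sigma_z z a b)^-1 * a * b).

Section BraceTheory.
Variable B : left_skew_brace.
Implicit Types a b c d x y z : B.

Let addA := groupA (brace_addP B).
Let add0l := group1l (brace_addP B).
Let add0r := group1r (brace_addP B).
Let addNl := groupVl (brace_addP B).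
Let addNr := groupVr (brace_addP B).
Let mulA := groupA (brace_mulP B).
Let mul1l := group1l (brace_mulP B).
Let mul1r := group1r (brace_mulP B).
Let mulVl := groupVl (brace_mulP B).
Let mulVr := groupVr (brace_mulP B).

Let addKl a b : - a + (a + b) = b.
Proof. by rewrite addA addNl add0l. Qed.

Let addKr a b : a + b - b = a.
Proof. by rewrite -addA addNr add0r. Qed.

Let addNKr a b : a - b + b = a.
Proof. by rewrite -addA addNl add0r. Qed.

Let addIl a b c : a + b = a + c -> b = c.
Proof. by move=> e; rewrite -(addKl a b) e addKl. Qed.

Let mulKl a b : a^-1 * (a * b) = b.
Proof. by rewrite mulA mulVl mul1l. Qed.

Let mulKVl a b : a * (a^-1 * b) = b.
Proof. by rewrite mulA mulVr mul1l. Qed.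

Lemma brace_mul0r a : a * 0 = a.
Proof.
have := brace_mulDr a 0 0; rewrite add0l -addA -{1}(add0r (a * 0)).
by move=> /addIl e; apply: (@addIl (- a)); rewrite -e addNl.
Qed.

Lemma brace_zero_one : (0 : B) = 1.
Proof. by rewrite -(mul1l 0) brace_mul0r. Qed.

Lemma brace_mulrN a b : a * (- b) = a - a * b + a.
Proof.
have := brace_mulDr a b (- b); rewrite addNr brace_mul0r => e.
apply: (@addIl (a * b - a)); rewrite -e.
by rewrite -[a - _ + a]addA addA addNKr addA addNr add0l.
Qed.

Lemma brace_mulrBD a b c d :
  a * (b - c + d) = a * b - a * c + a * d.
Proof.
rewrite !brace_mulDr brace_mulrN.
by rewrite !addA addNKr addKr.
Qed.

Lemma sigma_zM z a b c : sigma_z z a (sigma_z z b c) = sigma_z z (a * b) c.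
Proof. by rewrite /sigma_z brace_mulrBD !mulA addKr. Qed.

(* [r_z] preserves the product, and the factor [sigma_z z a b * sigma_z z a' c],
   where [a'] is the second component of [r_z z (a, b)], depends on [b], [c]
   only through [b * c]. *)
Lemma sigma_z_prod z a b c : u_distributive z ->
  sigma_z z a b * sigma_z z ((sigma_z z a b)^-1 * a * b) c
  = a * (b * c) - a * z * z + z * z.
Proof.
move=> hz; set u := sigma_z z a b.
rewrite [sigma_z _ _ c]/sigma_z brace_mulrBD -!mulA !mulKVl !mulA /u /sigma_z hz.
by rewrite !addA addNKr.
Qed.

Lemma r_z_braid z : u_distributive z -> braid_equation (r_z z).
Proof.
move=> hz [[a b] c]; rewrite /braid12 /braid23 /=.
set u := sigma_z z a b; set a' := u^-1 * a * b.
set v := sigma_z z b c; set b' := v^-1 * b * c.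
set w := sigma_z z a v; set a'' := w^-1 * a * v.
have uE : u * a' = a * b by rewrite /a' -mulA mulKVl.
have vE : v * b' = b * c by rewrite /b' -mulA mulKVl.
have wE : w * a'' = a * v by rewrite /a'' -mulA mulKVl.
set x := sigma_z z a' c; set x' := sigma_z z a'' b'.
have e1 : sigma_z z u x = w by rewrite /x /w /v !sigma_zM uE.
have e2 : u * x = w * x'.
  by rewrite /u /x /a' sigma_z_prod // /w /x' /a'' sigma_z_prod // vE.
have e3 : w^-1 * u * x = x' by rewrite -mulA e2 mulKl.
rewrite e1 e3; congr (_, _, _).
have xK d y : x^-1 * d * y = x^-1 * (d * y) by rewrite mulA.
have e4 : u * x * (x^-1 * a' * c) = w * x' * (x'^-1 * a'' * b').
  by rewrite -!mulA !mulKVl vE.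
by move: e4; rewrite e2 => /(congr1 (brace_mul (w * x')^-1)); rewrite !mulKl.
Qed.

Lemma sigma_z1 a b : sigma_z 1 a b = sigma a b.
Proof. by rewrite /sigma_z mul1r -brace_zero_one add0r. Qed.

Lemma u_distributive1 : u_distributive (1 : B).
Proof. by move=> a b c; rewrite !mul1r. Qed.

Lemma r_one_braid : braid_equation (@r_one B).
Proof.
have e (p : B * B) : r_one p = r_z 1 p by case: p => a b; rewrite /= sigma_z1.
move=> t; have := r_z_braid u_distributive1 t.
by rewrite /braid12 /braid23 /comp !e.
Qed.

End BraceTheory.

Definition solution_one (S : left_skew_brace) : yb_solution S :=
  YBSolution (@r_one_braid S).

Definition solution_z (B : left_skew_brace) (z : B) (hz : u_distributive z) :
    yb_solution B :=
  YBSolution (r_z_braid hz).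

(* Main.v *)
Require Import Defs.
From mathcomp Require Import ssreflect ssrfun.

Local Open Scope brace_scope.

(** The solution of [S] acts on pairs containing the neutral element by the
    flip: [r_one (a, 1) = (1, a)] and [r_one (1, b) = (b, 1)].  A homomorphism
    [f] carries both identities to [B]; writing [t] for [f 1], they say that
    every [x] in the image of [f] satisfies [sigma_z z x t = t],
    [sigma_z z t x = x] and [x * t = t * x].

    By [mul_sigma_z], each value of [sigma_z] determines the product.
    Applied to [sigma_z z t x = x], it gives [t * x = x - z + t * z].  At
    [x = 1] this reads [t * z = z + t] if [1] is in the image, so that
    [t * x = x + t] for all [x] in the image.  Hence [x * t = x + t], which is
    [t + x] when [t] and [x] commute additively.  On the other hand
    [sigma_z z x t = t] gives [x * t = t - z + x * z]; comparing the two and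
    cancelling [t] yields [x * z = z + x], which is exactly what is excluded
    for [x = eta]. *)

Lemma brace_addKN {B : left_skew_brace} (a b : B) : a + (- a + b) = b.
Proof.
by rewrite (groupA (brace_addP B)) (groupVr (brace_addP B))
  (group1l (brace_addP B)).
Qed.

Lemma brace_addNK {B : left_skew_brace} (a b : B) : - a + (a + b) = b.
Proof.
by rewrite (groupA (brace_addP B)) (groupVl (brace_addP B))
  (group1l (brace_addP B)).
Qed.

Lemma mul_sigma_z {B : left_skew_brace} (z a b : B) :
  a * b = sigma_z z a b - z + a * z.
Proof.
have addA := groupA (brace_addP B).
by rewrite /sigma_z -!addA brace_addKN (groupVl (brace_addP B))
  (group1r (brace_addP B)).
Qed.

Lemma r_one1r {S : left_skew_brace} (a : S) : r_one (a, 1) = (1, a).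
Proof.
have s1 : sigma a 1 = 1.
  rewrite /sigma (group1r (brace_mulP S)) (groupVr (brace_addP S)).
  exact: brace_zero_one.
have inv1 : 1^-1 = 1 :> S.
  by rewrite -[LHS](group1r (brace_mulP S)) (groupVl (brace_mulP S)).
by rewrite /r_one s1 inv1 (group1r (brace_mulP S)) (group1l (brace_mulP S)).
Qed.

Lemma r_one1l {S : left_skew_brace} (b : S) : r_one (1, b) = (b, 1).
Proof.
have s1 : sigma 1 b = b.
  rewrite -sigma_z1 /sigma_z !(group1l (brace_mulP S)).
  by rewrite -(groupA (brace_addP S)) (groupVl (brace_addP S))
    (group1r (brace_addP S)).
by rewrite /r_one s1 (group1r (brace_mulP S)) (groupVl (brace_mulP S)).
Qed.

Lemma yb_hom_sigma1r {B S : left_skew_brace} {z : B} {hz : u_distributive z}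
    {f : S -> B} (a : S) :
  yb_hom (solution_one S) (solution_z hz) f -> sigma_z z (f a) (f 1) = f 1.
Proof.
move=> hf; have : pair_map f (r_one (a, 1)) = r_z z (f a, f 1) := hf (a, 1).
by rewrite r_one1r => -[].
Qed.

Lemma yb_hom_sigma1l {B S : left_skew_brace} {z : B} {hz : u_distributive z}
    {f : S -> B} (b : S) :
  yb_hom (solution_one S) (solution_z hz) f -> sigma_z z (f 1) (f b) = f b.
Proof.
move=> hf; have : pair_map f (r_one (1, b)) = r_z z (f 1, f b) := hf (1, b).
by rewrite r_one1l => -[].
Qed.

(** [r_z] preserves the product of the two components, and it sends
    [(f a, f 1)] to [(f 1, f a)]. *)
Lemma yb_hom_mul1C {B S : left_skew_brace} {z : B} {hz : u_distributive z}
    {f : S -> B} (a : S) :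
  yb_hom (solution_one S) (solution_z hz) f -> f a * f 1 = f 1 * f a.
Proof.
move=> hf; have mulA := groupA (brace_mulP B).
have : pair_map f (r_one (a, 1)) = r_z z (f a, f 1) := hf (a, 1).
rewrite r_one1r /r_z (yb_hom_sigma1r _ hf) -mulA => -[e].
by rewrite {2}e mulA (groupVr (brace_mulP B)) (group1l (brace_mulP B)).
Qed.

(** The two [z]-terms of [f 1 * f s = f s - z + f 1 * z] collapse to [f 1]:
    the same identity at a preimage of [1] gives [f 1 * z = z + f 1]. *)
Lemma yb_hom_mul1E {B S : left_skew_brace} {z : B} {hz : u_distributive z}
    {f : S -> B} (s0 s : S) :
  yb_hom (solution_one S) (solution_z hz) f -> f s0 = 1 ->
  f 1 * f s = f s + f 1.
Proof.
move=> hf fs0; have addA := groupA (brace_addP B).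
have f1z : f 1 * z = z + f 1.
  have := mul_sigma_z z (f 1) (f s0).
  rewrite (yb_hom_sigma1l _ hf) fs0 (group1r (brace_mulP B)) -(brace_zero_one B).
  by rewrite (group1l (brace_addP B)) => {2}->; rewrite brace_addKN.
by rewrite (mul_sigma_z z) (yb_hom_sigma1l _ hf) f1z -addA brace_addNK.
Qed.

Theorem proposition2p20 (B S : left_skew_brace) (z : B)
    (hz : u_distributive z)
    (eta : B) (heta : z + eta <> eta * z)
    (f : S -> B)
    (f_eta : exists s : S, f s = eta) (f_one : exists s : S, f s = 1)
    (f1_eta : f 1 + eta = eta + f 1) :
  ~ yb_hom (solution_one S) (solution_z hz) f.
Proof.
move=> hf; case: f_eta f_one => s fs [s0 fs0]; apply: heta.
have mulE : eta * f 1 = f 1 + eta.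
  by rewrite f1_eta -fs (yb_hom_mul1C _ hf) (yb_hom_mul1E _ _ hf fs0).
have mulEz : eta * f 1 = f 1 + (- z + eta * z).
  by rewrite (mul_sigma_z z) -fs (yb_hom_sigma1r _ hf) (groupA (brace_addP B)).
have etaE : eta = - z + eta * z.
  by rewrite -[LHS](brace_addNK (f 1)) -mulE mulEz brace_addNK.
by rewrite {1}etaE brace_addKN.
Qed.
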